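(* Let $1\leqslant p<2$ and $1\leqslant q\leqslant p$. If $\boldsymbol{y}\in\mathbb{R}^d\setminus\mathcal{S}_p$, then $\mathbf{T}_{p,q}(\boldsymbol{y})=\boldsymbol{y}$ if and only if $\boldsymbol{y}$ is a (global) minimum point of $C_{p,q}$ over $\mathbb{R}^d$.
   Context: Data: $\boldsymbol{x}_1,\dots,\boldsymbol{x}_m\in\mathbb{R}^d$ are fixed data points, distinct and non-collinear, with weights $\eta_1,\dots,\eta_m>0$. Superscript $(t)$ denotes the $t$-th coordinate, $1\leqslant t\leqslant d$, and $\|\cdot\|_p$ is the $\ell_p$ norm on $\mathbb{R}^d$. Cost function: $C_{p,q}(\boldsymbol{y}):=\sum_{i=1}^m \eta_i^q\|\boldsymbol{y}-\boldsymbol{x}_i\|_p^q$ for $\boldsymbol{y}\in\mathbb{R}^d$. Singular set: $\mathcal{S}_p:=\{\boldsymbol{y}\in\mathbb{R}^d : \exists i\in\{1,\dots,m\},\ \exists t\in\{1,\dots,d\}\text{ such that } y^{(t)}=x_i^{(t)}\}$. Operator: for $\boldsymbol{y}\notin\mathcal{S}_p$, $\mathbf{T}_{p,q}(\boldsymbol{y})\in\mathbb{R}^d$ is defined coordinatewise by $$\big(\mathbf{T}_{p,q}(\boldsymbol{y})\big)^{(t)}:=\frac{\sum_{i=1}^m \eta_i^q\|\boldsymbol{y}-\boldsymbol{x}_i\|_p^{q-p}|y^{(t)}-x_i^{(t)}|^{p-2}x_i^{(t)}}{\sum_{i=1}^m \eta_i^q\|\boldsymbol{y}-\boldsymbol{x}_i\|_p^{q-p}|y^{(t)}-x_i^{(t)}|^{p-2}},\qquad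 1\leqslant t\leqslant d.$$ *)

(* Defs.v *)
From mathcomp Require Import all_boot all_order all_algebra.
From mathcomp Require Import classical_sets reals exp.

Set Implicit Arguments.
Unset Strict Implicit.
Unset Printing Implicit Defensive.

Import Order.TTheory GRing.Theory Num.Theory.

Local Open Scope classical_set_scope.
Local Open Scope ring_scope.

(* The direction [v] must be nonzero, so [a + R v] is a genuine line. *)
Definition collinear (R : realType) (d m : nat) (x : 'I_m -> 'rV[R]_d) : Prop :=
  exists a v : 'rV[R]_d, v != 0 /\ forall i, exists s : R, x i = a + s *: v.

(* The norm [`|v|] that MathComp-Analysis puts on matrices is the max norm,
   hence this explicit l_p norm. *)
Definition lpnorm (R : realType) (d : nat) (p : R) (v : 'rV[R]_d) : R :=
  (\sum_(t < d) `|v 0 t| `^ p) `^ p^-1.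

Definition cost (R : realType) (d m : nat) (x : 'I_m -> 'rV[R]_d)
    (eta : 'I_m -> R) (p q : R) (y : 'rV[R]_d) : R :=
  \sum_(i < m) eta i `^ q * lpnorm p (y - x i) `^ q.

Definition singular_set (R : realType) (d m : nat) (x : 'I_m -> 'rV[R]_d) :
    set 'rV[R]_d :=
  [set y | exists (i : 'I_m) (t : 'I_d), y 0 t = x i 0 t].

Definition weight (R : realType) (d m : nat) (x : 'I_m -> 'rV[R]_d)
    (eta : 'I_m -> R) (p q : R) (y : 'rV[R]_d) (i : 'I_m) (t : 'I_d) : R :=
  eta i `^ q * lpnorm p (y - x i) `^ (q - p) * `|y 0 t - x i 0 t| `^ (p - 2).

(* Total because [powR] and division are; only its values off
   [singular_set x], where all the bases raised to a power are positive, are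
   meaningful. *)
Definition T_op (R : realType) (d m : nat) (x : 'I_m -> 'rV[R]_d)
    (eta : 'I_m -> R) (p q : R) (y : 'rV[R]_d) : 'rV[R]_d :=
  \row_(t < d) ((\sum_(i < m) weight x eta p q y i t * x i 0 t) /
                (\sum_(i < m) weight x eta p q y i t)).

(* Main.v *)
Require Import Defs.
From mathcomp Require Import all_boot all_order all_algebra.
From mathcomp Require Import classical_sets reals exp.
From mathcomp Require Import boolp topology normedtype sequences derive.
From mathcomp Require Import ring lra.

Set Implicit Arguments.
Unset Strict Implicit.
Unset Printing Implicit Defensive.

Import Order.TTheory GRing.Theory Num.Theory.
Import numFieldNormedType.Exports.

Local Open Scope classical_set_scope.
Local Open Scope ring_scope.

(** The numerator of the [t]-th coordinate of [T y], minus [y 0 t] times its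
    positive denominator, is up to sign the [t]-th partial derivative of the
    cost at [y] divided by [q]. So [T y = y] says that the gradient of
    the cost vanishes at [y], and for a convex function this is the same as
    global minimality.

    The argument never differentiates the cost. Its convexity enters through
    the subgradient inequality [cost_subgradient], which holds with the formal
    gradient [q * reduced_gradient] at every base point, singular ones
    included. It comes, term by term, from the inequality for
    [lpnorm p v `^ q] in [lpnorm_powR_subgradient]: Hoelder bounds the pairing
    of [v] with the gradient of the norm at [u] by the norm of [v], and the
    exponent [q >= 1] is absorbed by Young's inequality for two numbers.

    If the gradient vanishes at [y], the subgradient inequality at [y] is
    minimality. Conversely, let [y] be a minimum point, [g] its reduced
    gradient, and move to [f s = y - s g] with [s > 0]. The subgradient
    inequality at [f s], evaluated at [y], together with
    [cost y <= cost (f s)], shows that the gradient at [f s] pairs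
    nonpositively with [g]. The gradient is continuous at nonsingular points,
    so letting [s] tend to [0] gives [|g|^2 <= 0].

    Noncollinearity guarantees that there is a data point, so that the
    denominators in [T] are positive. *)

(** Young's inequality for the exponent pair [p/(p-1)], [p], written without
    the conjugate exponent so that it includes [p = 1]. In logarithmic
    coordinates, with [L = ln b - ln a], it is the combination,
    with coefficients [p - 1] and [1], of the tangent-line bounds
    [exp (- L) >= 1 - L] and [exp ((p - 1) L) >= 1 + (p - 1) L]. *)
Lemma powR_young (R : realType) (p a b : R) : 1 <= p -> 0 <= a -> 0 <= b ->
  p * (a `^ (p - 1) * b) <= (p - 1) * a `^ p + b `^ p.
Proof.
move=> p1 a0 b0.
have p0 : p != 0 by rewrite gt_eqF// (lt_le_trans ltr01).
have [->|an0] := eqVneq a 0.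
  rewrite (powR0 p0) mulr0 add0r.
  have [->|pn1] := eqVneq p 1; first by rewrite subrr powRr0 !mul1r powRr1.
  by rewrite powR0 ?subr_eq0// mul0r mulr0 powR_ge0.
have {}a0 : 0 < a by rewrite lt_def an0.
have [->|bn0] := eqVneq b 0.
  by rewrite !mulr0 addr_ge0 ?mulr_ge0 ?powR_ge0 ?subr_ge0.
have {}b0 : 0 < b by rewrite lt_def bn0.
have [aE bE] : a = expR (ln a) /\ b = expR (ln b) by rewrite !lnK.
(* Each of the three terms is [E = a `^ (p - 1) * b] times an exponential
   of a multiple of [L], and [E] cancels. *)
rewrite /powR !gt_eqF// {1}bE; set A := ln a; set B := ln b.
set L := B - A.
have -> : (p - 1) * A = p * A - A by ring.
rewrite -expRD.
have -> : p * A - A + B = p * A + L by rewrite /L; ring.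
have -> : p * B = p * A + L + (p - 1) * L by rewrite /L; ring.
have -> : p * A = p * A + L - L by ring.
rewrite subrK [expR (_ - L)]expRD [expR (_ + (p - 1) * L)]expRD.
have E0 := expR_gt0 (p * A + L); set E := expR (p * A + L) in E0 *.
have h1 := expR_ge1Dx (- L); have h2 := expR_ge1Dx ((p - 1) * L).
have -> : (p - 1) * (E * expR (- L)) + E * expR ((p - 1) * L) =
  E * ((p - 1) * expR (- L) + expR ((p - 1) * L)) by ring.
rewrite mulrC ler_pM2l//.
have : (p - 1) * (1 - L) <= (p - 1) * expR (- L).
  by rewrite ler_wpM2l// subr_ge0.
lra.
Qed.

Lemma lpnorm_ge0 (R : realType) (d : nat) (p : R) (v : 'rV[R]_d) :
  0 <= lpnorm p v.
Proof. exact: powR_ge0. Qed.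

Lemma lpnorm_powR (R : realType) (d : nat) (p : R) (v : 'rV[R]_d) : p != 0 ->
  lpnorm p v `^ p = \sum_(t < d) `|v 0 t| `^ p.
Proof.
move=> p0; rewrite /lpnorm -powRrM mulVf// powRr1//.
by apply: sumr_ge0 => t _; exact: powR_ge0.
Qed.

Lemma lpnorm_eq0 (R : realType) (d : nat) (p : R) (v : 'rV[R]_d) (t : 'I_d) :
  lpnorm p v = 0 -> v 0 t = 0.
Proof.
move=> /powR_eq0_eq0 /psumr_eq0P => /(_ (fun s _ => powR_ge0 _ _)).
by move=> /(_ t isT) /powR_eq0_eq0 /normr0_eq0.
Qed.

Lemma lpnorm_gt0 (R : realType) (d : nat) (p : R) (v : 'rV[R]_d) (t : 'I_d) :
  v 0 t != 0 -> 0 < lpnorm p v.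
Proof.
move=> vt; rewrite lt_def lpnorm_ge0 andbT.
by apply: contra vt => /eqP /lpnorm_eq0 ->.
Qed.

(** Rescaling [u] by the norm of [v] and [v] by the norm of [u] makes the two
    norms equal; Young's inequality summed over the coordinates is then exactly
    the bound, multiplied by the constant [c0] below. *)
Lemma lpnorm_holder (R : realType) (d : nat) (p : R) (u v : 'rV[R]_d) :
  1 <= p -> 0 < lpnorm p u ->
  \sum_(t < d) `|u 0 t| `^ (p - 1) * `|v 0 t| <=
  lpnorm p u `^ (p - 1) * lpnorm p v.
Proof.
move=> p1 N0; have p0 : 0 < p := lt_le_trans ltr01 p1.
have pn0 : p != 0 by rewrite gt_eqF.
have [M0|Mn0] := eqVneq (lpnorm p v) 0.
  rewrite M0 mulr0 big1// => t _.
  by rewrite (lpnorm_eq0 _ M0) normr0 mulr0.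
have M0 : 0 < lpnorm p v by rewrite lt_def Mn0 lpnorm_ge0.
have NE := lpnorm_powR u pn0; have ME := lpnorm_powR v pn0.
move: (lpnorm p u) (lpnorm p v) NE ME N0 M0 {Mn0} => N M NE ME N0 M0.
have c0 : 0 < p * (M `^ (p - 1) * N).
  by apply: mulr_gt0 => //; apply: mulr_gt0 => //; exact: powR_gt0.
rewrite -(ler_pM2l c0).
have -> : p * (M `^ (p - 1) * N) * (N `^ (p - 1) * M) =
    (p - 1) * (M `^ p * N `^ p) + N `^ p * M `^ p.
  by rewrite -(mulr_powRB1 (ltW N0) p0) -(mulr_powRB1 (ltW M0) p0); ring.
rewrite [in X in _ <= _ + X]ME [in X in _ <= X + _]NE !mulr_sumr.
rewrite -big_split/= ler_sum// => t _.
have := @powR_young _ p (`|u 0 t| * M) (`|v 0 t| * N) p1.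
rewrite !mulr_ge0 ?(ltW M0) ?(ltW N0)// => /(_ isT isT).
rewrite !powRM ?(ltW M0) ?(ltW N0)// => young.
apply: le_trans (le_trans young _); rewrite le_eqVlt; apply/orP; left.
  by apply/eqP; ring.
by apply/eqP; ring.
Qed.

(** Convexity of the [q]-th power of the [l_p] norm, as the position of its
    graph above the tangent plane at [u]. Where [u] or one of its coordinates
    vanishes, the corresponding terms are [0] because of the factor [u 0 t],
    whatever the value of the powers with a negative exponent. *)
Lemma lpnorm_powR_subgradient (R : realType) (d : nat) (p q : R)
    (u v : 'rV[R]_d) : 1 <= p -> 1 <= q ->
  lpnorm p u `^ q + q * \sum_(t < d)
    lpnorm p u `^ (q - p) * `|u 0 t| `^ (p - 2) * u 0 t * (v 0 t - u 0 t) <=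
  lpnorm p v `^ q.
Proof.
move=> p1 q1; have p0 : 0 < p := lt_le_trans ltr01 p1.
have q0 : 0 < q := lt_le_trans ltr01 q1.
have [N0|Nn0] := eqVneq (lpnorm p u) 0.
  rewrite big1 => [|t _]; last by rewrite (lpnorm_eq0 _ N0) mulr0 mul0r.
  by rewrite mulr0 addr0 N0 powR0 ?gt_eqF// powR_ge0.
have N0 : 0 < lpnorm p u by rewrite lt_def Nn0 lpnorm_ge0.
have powN r s : lpnorm p u `^ (r + s) = lpnorm p u `^ r * lpnorm p u `^ s.
  by rewrite powRD// Nn0 implybT.
have sqrE t : `|u 0 t| `^ (p - 2) * (u 0 t * u 0 t) = `|u 0 t| `^ p.
  have [->|ut0] := eqVneq (u 0 t) 0.
    by rewrite !mulr0 normr0 powR0// gt_eqF.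
  have -> : u 0 t * u 0 t = `|u 0 t| `^ 2.
    by rewrite powR_mulrn// -normrX ger0_norm ?sqr_ge0// expr2.
  by rewrite -powRD ?subrK// normr_eq0 ut0 implybT.
have leE t : `|u 0 t| `^ (p - 2) * (u 0 t * v 0 t) <=
    `|u 0 t| `^ (p - 1) * `|v 0 t|.
  have [->|ut0] := eqVneq (u 0 t) 0.
    by rewrite !mul0r mulr0 mulr_ge0// powR_ge0.
  have -> : p - 1 = p - 2 + 1 by ring.
  rewrite (@powRD _ _ (p - 2)) ?normr_eq0 ?ut0 ?implybT// powRr1//.
  by rewrite -mulrA -normrM ler_wpM2l ?powR_ge0// ler_norm.
(* The sum is a pairing with [v - u]: with [u] it is the [q]-th power of the
   norm, with [v] it is bounded by Hoelder. *)
have step : \sum_(t < d)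
    lpnorm p u `^ (q - p) * `|u 0 t| `^ (p - 2) * u 0 t * (v 0 t - u 0 t) <=
    lpnorm p u `^ (q - 1) * lpnorm p v - lpnorm p u `^ q.
  have -> : q - 1 = (q - p) + (p - 1) by ring.
  rewrite -[X in _ - _ `^ X](subrK p q) !(powN (q - p)) -mulrA -mulrBr.
  apply: (@le_trans _ _ (lpnorm p u `^ (q - p) * (\sum_(t < d)
      `|u 0 t| `^ (p - 1) * `|v 0 t| - \sum_(t < d) `|u 0 t| `^ p))).
    rewrite -sumrB mulr_sumr ler_sum// => t _.
    rewrite -!mulrA ler_wpM2l ?powR_ge0// mulrBr mulrBr sqrE lerD2r.
    exact: leE.
  rewrite ler_wpM2l ?powR_ge0// lpnorm_powR ?gt_eqF// lerD2r.
  exact: lpnorm_holder.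
have young := powR_young q1 (lpnorm_ge0 p u) (lpnorm_ge0 p v).
have /le_trans := ler_wpM2l (ltW q0) step; rewrite -lerBrDl; apply.
rewrite mulrBr lerBlDr; apply: le_trans young _.
by rewrite mulrBl mul1r addrC addrA addrAC.
Qed.

(** The gradient of [cost x eta p q] at a nonsingular [z], divided by [q]. *)
Definition reduced_gradient (R : realType) (d m : nat) (x : 'I_m -> 'rV[R]_d)
    (eta : 'I_m -> R) (p q : R) (z : 'rV[R]_d) (t : 'I_d) : R :=
  \sum_(i < m) weight x eta p q z i t * (z 0 t - x i 0 t).

Lemma cost_subgradient (R : realType) (d m : nat) (x : 'I_m -> 'rV[R]_d)
    (eta : 'I_m -> R) (p q : R) (y z : 'rV[R]_d) : 1 <= p -> 1 <= q ->
  cost x eta p q y +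
    q * \sum_(t < d) reduced_gradient x eta p q y t * (z 0 t - y 0 t) <=
  cost x eta p q z.
Proof.
move=> p1 q1; rewrite /cost /reduced_gradient.
under [X in q * X]eq_bigr do rewrite mulr_suml.
rewrite exchange_big/= mulr_sumr -big_split/= ler_sum// => i _.
have := @lpnorm_powR_subgradient _ _ p q (y - x i) (z - x i) p1 q1.
move=> /(ler_wpM2l (powR_ge0 (eta i) q)); apply: le_trans.
rewrite mulrDr lerD2l mulrCA ler_pM2l ?(lt_le_trans ltr01 q1)//.
rewrite mulr_sumr ler_sum// => t _; rewrite !mxE /weight.
rewrite le_eqVlt; apply/orP; left; apply/eqP; ring.
Qed.

Lemma cvg_powR (R : realType) (T : Type) (F : set_system T) (FF : Filter F)
    (f : T -> R) (a r : R) : 0 < a -> f s @[s --> F] --> a ->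
  f s `^ r @[s --> F] --> a `^ r.
Proof.
move=> a0 fa; apply: (cvg_comp f (@powR R ^~ r) fa).
suff : {for a, continuous (@powR R ^~ r)} by [].
apply: differentiable_continuous; apply/derivable1_diffP.
by apply: derivable_powR; rewrite in_itv/= a0.
Qed.

Lemma nonsingular_sub_neq0 (R : realType) (d m : nat) (x : 'I_m -> 'rV[R]_d)
    (y : 'rV[R]_d) (i : 'I_m) (t : 'I_d) :
  ~ singular_set x y -> y 0 t - x i 0 t != 0.
Proof.
by move=> yS; rewrite subr_eq0; apply: contra_notN yS => /eqP ?; exists i, t.
Qed.

(** At a nonsingular point every base of a power in the weights is positive,
    so negative exponents do no harm. Convergence is asked of the coordinates,
    which is the form in which the descent path supplies it. *)
Lemma cvg_reduced_gradient (R : realType) (d m : nat) (x : 'I_m -> 'rV[R]_d)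
    (eta : 'I_m -> R) (p q : R) (T : Type) (F : set_system T) (FF : Filter F)
    (f : T -> 'rV[R]_d) (y : 'rV[R]_d) (t : 'I_d) :
  ~ singular_set x y -> (forall r, f s 0 r @[s --> F] --> y 0 r) ->
  reduced_gradient x eta p q (f s) t @[s --> F] -->
  reduced_gradient x eta p q y t.
Proof.
move=> yS fy.
have yx i r := nonsingular_sub_neq0 i r yS.
have fyx i r : f s 0 r - x i 0 r @[s --> F] --> y 0 r - x i 0 r.
  by apply: cvgB; [exact: fy|exact: cvg_cst].
have cvg_abs i r e :
    `|f s 0 r - x i 0 r| `^ e @[s --> F] --> `|y 0 r - x i 0 r| `^ e.
  by apply: cvg_powR; [rewrite normr_gt0|exact: cvg_norm].
rewrite /reduced_gradient; apply: cvg_big => [|i _].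
  exact: add_continuous.
apply: cvgM => //; apply: cvgM => //; apply: cvgM; first exact: cvg_cst.
have sumE (w : 'rV[R]_d) : \sum_(r < d) `|(w - x i) 0 r| `^ p =
    \sum_(r < d) `|w 0 r - x i 0 r| `^ p.
  by apply: eq_bigr => r _; rewrite !mxE.
apply: cvg_powR; first by apply: (@lpnorm_gt0 _ _ _ _ t); rewrite !mxE.
rewrite /lpnorm.
under eq_fun do rewrite sumE.
rewrite sumE.
apply: cvg_powR; last by apply: cvg_big => //; exact: add_continuous.
rewrite (bigD1 t)//= ltr_pwDl// ?powR_gt0 ?normr_gt0//.
by apply: sumr_ge0 => r _; exact: powR_ge0.
Qed.

(** The first-order criterion of convex optimization. For the converse, the
    steepest descent path [f] from [y] is compared with [y] by the subgradient
    inequality based at [f s] rather than at [y]. *)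
Lemma reduced_gradient_eq0_minimum (R : realType) (d m : nat)
    (x : 'I_m -> 'rV[R]_d) (eta : 'I_m -> R) (p q : R) (y : 'rV[R]_d) :
  1 <= p -> 1 <= q -> ~ singular_set x y ->
  (forall t, reduced_gradient x eta p q y t = 0) <->
  (forall z, cost x eta p q y <= cost x eta p q z).
Proof.
move=> p1 q1 yS; split=> [g0 z|ymin].
  apply: le_trans (cost_subgradient x eta y z p1 q1).
  by rewrite big1 ?mulr0 ?addr0// => t _; rewrite g0 mul0r.
set g := reduced_gradient x eta p q y.
pose f (s : R) : 'rV[R]_d := y - s *: \row_t g t.
have fE s t : f s 0 t = y 0 t - s * g t by rewrite !mxE.
have fy t : f s 0 t @[s --> 0^'+] --> y 0 t.
  under eq_fun do rewrite fE.
  suff : y 0 t - s * g t @[s --> 0^'+] --> y 0 t - 0 * g t.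
    by rewrite mul0r subr0.
  apply: cvgB; first exact: cvg_cst.
  by apply: cvgMr_tmp; apply: cvg_at_right_filter; exact: cvg_id.
have sq_le0 : \sum_(t < d) g t * g t <= 0.
  have cvgS : \sum_(t < d) reduced_gradient x eta p q (f s) t * g t
      @[s --> 0^'+] --> \sum_(t < d) g t * g t.
    apply: cvg_big => [|t _]; first exact: add_continuous.
    apply: cvgM; last exact: cvg_cst.
    exact: cvg_reduced_gradient.
  apply: (cvgr_to_le cvgS); near=> s.
  have s0 : 0 < s by near: s; exact: nbhs_right_gt.
  have := le_trans (cost_subgradient x eta (f s) y p1 q1) (ymin (f s)).
  rewrite gerDl pmulr_rle0 ?(lt_le_trans ltr01)//.
  under eq_bigr do rewrite fE opprB addrCA subrr addr0 mulrCA.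
  by rewrite -mulr_sumr pmulr_rle0.
have sq_ge0 t : true -> 0 <= g t * g t by rewrite -expr2 sqr_ge0.
have /(psumr_eq0P sq_ge0) sq0 : \sum_(t < d) g t * g t = 0.
  by apply/le_anti; rewrite sq_le0 sumr_ge0.
by move=> t; apply/eqP; have /eqP := sq0 t isT; rewrite mulf_eq0 orbb.
Unshelve. all: by end_near. Qed.

(** [T y] is a weighted mean of the data points in each coordinate, so it is
    fixed exactly when the weighted residuals [y - x i] cancel, provided the
    total weight is nonzero. A family of no points lies on any line, so
    noncollinearity supplies a point as soon as a coordinate exists. *)
Lemma T_op_fixed (R : realType) (d m : nat) (x : 'I_m -> 'rV[R]_d)
    (eta : 'I_m -> R) (p q : R) (y : 'rV[R]_d) :
  ~ collinear x -> (forall i, 0 < eta i) -> ~ singular_set x y ->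
  T_op x eta p q y = y <-> forall t, reduced_gradient x eta p q y t = 0.
Proof.
move=> xNcol eta0 yS.
have W0 t : 0 < \sum_(i < m) weight x eta p q y i t.
  have yx i r := nonsingular_sub_neq0 i r yS.
  have w0 i : 0 < weight x eta p q y i t.
    have N0 : 0 < lpnorm p (y - x i).
      by apply: (@lpnorm_gt0 _ _ _ _ t); rewrite !mxE.
    by rewrite /weight !mulr_gt0 ?(powR_gt0 _ N0) ?powR_gt0 ?normr_gt0.
  case: m x eta eta0 xNcol yS yx w0 => [|n] x eta eta0 xNcol yS yx w0.
    case: xNcol; exists 0, (const_mx 1); split=> [|[]//].
    by apply/eqP => /matrixP/(_ 0 t)/eqP; rewrite !mxE oner_eq0.
  rewrite big_ord_recl ltr_pwDl// sumr_ge0// => i _; exact: ltW.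
have gE t : reduced_gradient x eta p q y t =
    (\sum_(i < m) weight x eta p q y i t) * y 0 t -
    \sum_(i < m) weight x eta p q y i t * x i 0 t.
  by rewrite mulr_suml -sumrB; apply: eq_bigr => i _; rewrite mulrBr.
have TE t : (T_op x eta p q y 0 t == y 0 t) =
    (reduced_gradient x eta p q y t == 0).
  rewrite mxE gE subr_eq0 -[LHS](inj_eq (mulIf (lt0r_neq0 (W0 t)))).
  by rewrite divfK ?lt0r_neq0// mulrC eq_sym.
split=> [Ty t|g0]; first by apply/eqP; rewrite -TE Ty.
by apply/rowP => t; apply/eqP; rewrite TE g0.
Qed.

Theorem corollary2 (R : realType) (d m : nat)
    (x : 'I_m -> 'rV[R]_d) (eta : 'I_m -> R) (p q : R)
    (x_distinct : injective x) (x_noncollinear : ~ collinear x)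
    (eta_gt0 : forall i, 0 < eta i)
    (p_ge1 : 1 <= p) (p_lt2 : p < 2) (q_ge1 : 1 <= q) (q_le_p : q <= p)
    (y : 'rV[R]_d) (y_nonsingular : ~ singular_set x y) :
  T_op x eta p q y = y <->
  (forall z : 'rV[R]_d, cost x eta p q y <= cost x eta p q z).
Proof.
exact: iff_trans (T_op_fixed p q x_noncollinear eta_gt0 y_nonsingular)
  (reduced_gradient_eq0_minimum eta p_ge1 q_ge1 y_nonsingular).
Qed.
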